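(* Let $\mathcal{A}$ be a pointed category with kernels and cokernels, and let $\mathcal{C}$ be the category of composable pairs $A=(A_0\xrightarrow{d_0^A}A_1\xrightarrow{d_1^A}A_2)$ of morphisms in $\mathcal{A}$ with $d_1^Ad_0^A=0$. Let $(\mathcal{T},\mathcal{F})$ be the near-torsion theory in $\mathcal{C}$ in which $\mathcal{T}$ consists of all cokernel diagrams ($A\in\mathcal{T}\Leftrightarrow d_1^A=\mathrm{coker}(d_0^A)$) and $\mathcal{F}$ consists of all kernel diagrams ($A\in\mathcal{F}\Leftrightarrow d_0^A=\mathrm{ker}(d_1^A)$), and let $\mathcal{C}_{\mathcal{T},\mathcal{F}}$ be the associated full subcategory of $\mathcal{C}$ defined in the context. Then an object $B$ in $\mathcal{C}$ belongs to $\mathcal{C}_{\mathcal{T},\mathcal{F}}$ if and only if it satisfies the following conditions: (a) the morphism $d_0^B$ admits an (epi, normal mono)-factorization; (b) the morphism $d_1^B$ admits a (normal epi, mono)-factorization; (c) the morphisms $d_0^B$ and $\mathrm{ker}(d_1^B)$ have the same cokernels, or, equivalently, the morphisms $d_1^B$ and $\mathrm{coker}(d_0^B)$ have the same kernels.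
   Context: A normal monomorphism is a morphism that is a kernel of some morphism; a normal epimorphism is a morphism that is a cokernel of some morphism. An (epi, normal mono)-factorization of $u$ is a factorization $u=me$ with $e$ an epimorphism and $m$ a normal monomorphism; a (normal epi, mono)-factorization is $u=me$ with $e$ a normal epimorphism and $m$ a monomorphism. ''$d_0$ and $\mathrm{ker}(d_1)$ have the same cokernels'' means that the canonical morphism $\mathrm{Coker}(d_0)\to\mathrm{Coker}(\mathrm{ker}(d_1))$ is an isomorphism; ''$d_1$ and $\mathrm{coker}(d_0)$ have the same kernels'' means that the canonical morphism $\mathrm{Ker}(\mathrm{coker}(d_0))\to\mathrm{Ker}(d_1)$ is an isomorphism. Morphisms $A\to A'$ in $\mathcal{C}$ are triples $(A_i\to A'_i)_{i=0,1,2}$ commuting with the $d_i$. A near-torsion theory in a category $\mathcal{C}$ is a pair $(\mathcal{T},\mathcal{F})$ of full replete subcategories such that $\mathcal{T}$ is coreflective, with coreflector $t$ (a left inverse of the inclusion) and counit $\varepsilon_A:t(A)\to A$; $\mathcal{F}$ is reflective, with reflector $f$ (a left inverse of the inclusion) and unit $\eta_A:A\to f(A)$; $A\in\mathcal{F}\Rightarrow t(A)\in\mathcal{F}$; and $A\in\mathcal{T}\Rightarrow f(A)\in\mathcal{T}$. In the present case, $t(A)=(A_0\xrightarrow{d_0}A_1\xrightarrow{\mathrm{coker}(d_0)}\mathrm{Coker}(d_0))$ with $\varepsilon_A=(1_{A_0},1_{A_1},d'_1)$, where $d_1'\,\mathrm{coker}(d_0)=d_1$; and $f(A)=(\mathrm{Ker}(d_1)\xrightarrow{\mathrm{ker}(d_1)}A_1\xrightarrow{d_1}A_2)$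 with $\eta_A=(d'_0,1_{A_1},1_{A_2})$, where $\mathrm{ker}(d_1)\,d_0'=d_0$ (the (co)kernels being chosen so that $t(A)=A$ for $A\in\mathcal{T}$ and $f(A)=A$ for $A\in\mathcal{F}$). For a near-torsion theory $(\mathcal{T},\mathcal{F})$ in $\mathcal{C}$: $\mathring{\mathcal{T}}$ is the full subcategory of those $T\in\mathcal{T}$ for which $\eta_T$ is an epimorphism in $\mathcal{C}$; $\mathring{\mathcal{F}}$ is the full subcategory of those $F\in\mathcal{F}$ for which $\varepsilon_F$ is a monomorphism in $\mathcal{C}$; and $\mathcal{C}_{\mathcal{T},\mathcal{F}}$ is the full subcategory of $\mathcal{C}$ of those $B$ such that $t(B)\in\mathring{\mathcal{T}}$, $f(B)\in\mathring{\mathcal{F}}$, the square $\eta_B\varepsilon_B=\varepsilon_{f(B)}t(\eta_B)$ (vertices $t(B),tf(B),B,f(B)$) is a pullback in $\mathcal{C}$, and the square $\eta_B\varepsilon_B=f(\varepsilon_B)\eta_{t(B)}$ (vertices $t(B),ft(B),B,f(B)$) is a pushout in $\mathcal{C}$. *)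

(* Defs.v *)
(* Morphisms are compared with Leibniz equality.  All subcategories are full,
   hence given by predicates on objects. *)
From Stdlib Require Import ClassicalEpsilon ProofIrrelevance.

Set Implicit Arguments.
Unset Strict Implicit.
Unset Printing Implicit Defensive.

Record category := Category {
  ob :> Type;
  hom : ob -> ob -> Type;
  idm : forall X, hom X X;
  comp : forall X Y Z, hom Y Z -> hom X Y -> hom X Z;
  comp1m : forall X Y (f : hom X Y), comp (idm Y) f = f;
  compm1 : forall X Y (f : hom X Y), comp f (idm X) = f;
  compA : forall X Y Z W (h : hom Z W) (g : hom Y Z) (f : hom X Y),
    comp h (comp g f) = comp (comp h g) f
}.
Arguments hom {c} X Y.
Arguments idm {c} X.
Arguments comp {c X Y Z} g f.
Notation "g ∘ f" := (comp g f) (at level 40, left associativity).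

Section InCategory.
Variable C : category.

Definition mono (X Y : C) (m : hom X Y) : Prop :=
  forall (W : C) (a b : hom W X), m ∘ a = m ∘ b -> a = b.

Definition epi (X Y : C) (e : hom X Y) : Prop :=
  forall (Z : C) (a b : hom Y Z), a ∘ e = b ∘ e -> a = b.

Definition iso (X Y : C) (f : hom X Y) : Prop :=
  exists g : hom Y X, g ∘ f = idm X /\ f ∘ g = idm Y.

(*  P --p2--> Y
    |         |
    p1        g
    v         v
    X --f---> Z  *)
Definition is_pullback (P X Y Z : C)
    (p1 : hom P X) (p2 : hom P Y) (f : hom X Z) (g : hom Y Z) : Prop :=
  f ∘ p1 = g ∘ p2 /\
  forall (W : C) (a : hom W X) (b : hom W Y), f ∘ a = g ∘ b ->
    exists! h : hom W P, p1 ∘ h = a /\ p2 ∘ h = b.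

(*  Z --g---> Y
    |         |
    f         i2
    v         v
    X --i1--> P  *)
Definition is_pushout (Z X Y P : C)
    (f : hom Z X) (g : hom Z Y) (i1 : hom X P) (i2 : hom Y P) : Prop :=
  i1 ∘ f = i2 ∘ g /\
  forall (W : C) (a : hom X W) (b : hom Y W), a ∘ f = b ∘ g ->
    exists! h : hom P W, h ∘ i1 = a /\ h ∘ i2 = b.

Definition replete (S : C -> Prop) : Prop :=
  forall (X Y : C) (f : hom X Y), iso f -> S X -> S Y.

(* A morphism together with its domain and codomain, so that morphisms whose
   (co)domains are only provably equal can be compared. *)
Definition arrow (X Y : C) (f : hom X Y) : {X : C & {Y : C & hom X Y}} :=
  existT _ X (existT _ Y f).

Lemma arrow_conj_dom (X Y X' Y' : C) (u : hom X' X) (v : hom Y' Y)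
    (g : hom X Y) (g' : hom X' Y') :
  existT (fun Z => hom Z X) X' u = existT (fun Z => hom Z X) X (idm X) ->
  existT (fun Z => hom Z Y) Y' v = existT (fun Z => hom Z Y) Y (idm Y) ->
  g ∘ u = v ∘ g' -> arrow g' = arrow g.
Proof.
intros eu ev.
assert (G : forall (a : {Z : C & hom Z X}) (b : {Z : C & hom Z Y}) g',
  a = existT (fun Z => hom Z X) X (idm X) ->
  b = existT (fun Z => hom Z Y) Y (idm Y) ->
  g ∘ projT2 a = projT2 b ∘ g' -> arrow g' = arrow g).
{ intros a b k -> ->; simpl in *; rewrite comp1m, compm1; now intros ->. }
exact (G (existT (fun Z => hom Z X) _ u) (existT (fun Z => hom Z Y) _ v) g' eu ev).
Qed.

Lemma arrow_conj_cod (X Y X' Y' : C) (u : hom X X') (v : hom Y Y')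
    (g : hom X Y) (g' : hom X' Y') :
  existT (fun Z => hom X Z) X' u = existT _ X (idm X) ->
  existT (fun Z => hom Y Z) Y' v = existT _ Y (idm Y) ->
  g' ∘ u = v ∘ g -> arrow g' = arrow g.
Proof.
intros eu ev.
assert (G : forall (a : {Z : C & hom X Z}) (b : {Z : C & hom Y Z}) g',
  a = existT _ X (idm X) -> b = existT _ Y (idm Y) ->
  g' ∘ projT2 a = projT2 b ∘ g -> arrow g' = arrow g).
{ intros a b k -> ->; simpl in *; rewrite comp1m, compm1; now intros ->. }
exact (G (existT _ _ u) (existT _ _ v) g' eu ev).
Qed.

End InCategory.

Record functor (C D : category) := Functor {
  fob :> C -> D;
  fmap : forall X Y : C, hom X Y -> hom (fob X) (fob Y);
  fmap1 : forall X : C, fmap (idm X) = idm (fob X);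
  fmapM : forall (X Y Z : C) (g : hom Y Z) (f : hom X Y),
    fmap (g ∘ f) = fmap g ∘ fmap f
}.
Arguments fmap {C D} _ {X Y} _.

(* A right adjoint of the inclusion of the full subcategory S, presented as an
   endofunctor of C with values in S; [coreflector_id] says that it is a left
   inverse of the inclusion, strictly, both on objects and on morphisms. *)
Record coreflection (C : category) (S : C -> Prop) := Coreflection {
  coreflector :> functor C C;
  counit : forall A : C, hom (coreflector A) A;
  coreflector_in : forall A : C, S (coreflector A);
  counit_natural : forall (A B : C) (g : hom A B),
    g ∘ counit A = counit B ∘ fmap coreflector g;
  counit_universal : forall (X A : C) (g : hom X A), S X ->
    exists! h : hom X (coreflector A), counit A ∘ h = g;
  coreflector_id : forall (X Y : C) (g : hom X Y), S X -> S Y ->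
    arrow (fmap coreflector g) = arrow g
}.

Record reflection (C : category) (S : C -> Prop) := Reflection {
  reflector :> functor C C;
  unit : forall A : C, hom A (reflector A);
  reflector_in : forall A : C, S (reflector A);
  unit_natural : forall (A B : C) (g : hom A B),
    fmap reflector g ∘ unit A = unit B ∘ g;
  unit_universal : forall (A X : C) (g : hom A X), S X ->
    exists! h : hom (reflector A) X, h ∘ unit A = g;
  reflector_id : forall (X Y : C) (g : hom X Y), S X -> S Y ->
    arrow (fmap reflector g) = arrow g
}.

Record near_torsion_theory (C : category) := NearTorsionTheory {
  tors : C -> Prop;
  tfree : C -> Prop;
  tors_replete : replete tors;
  tfree_replete : replete tfree;
  tpart : coreflection tors;
  fpart : reflection tfree;
  tpart_tfree : forall A : C, tfree A -> tfree (tpart A);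
  fpart_tors : forall A : C, tors A -> tors (fpart A)
}.

Section AssociatedSubcategory.
Variables (C : category) (N : near_torsion_theory C).
Let t := tpart N.
Let f := fpart N.
Let eps (A : C) : hom (t A) A := counit t A.
Let eta (A : C) : hom A (f A) := unit f A.

Definition tors_ring (X : C) : Prop := tors N X /\ epi (eta X).

Definition tfree_ring (X : C) : Prop := tfree N X /\ mono (eps X).

Definition C_TF (B : C) : Prop :=
  tors_ring (t B) /\
  tfree_ring (f B) /\
  is_pullback (eps B) (fmap t (eta B)) (eta B) (eps (f B)) /\
  is_pushout (eps B) (eta (t B)) (eta B) (fmap f (eps B)).

End AssociatedSubcategory.

Record pointed_category := PointedCategory {
  pcat :> category;
  zob : pcat;
  to_zob : forall X : pcat, hom X zob;
  from_zob : forall X : pcat, hom zob X;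
  to_zob_unique : forall (X : pcat) (f : hom X zob), f = to_zob X;
  from_zob_unique : forall (X : pcat) (f : hom zob X), f = from_zob X
}.

Section Pointed.
Variable A : pointed_category.

Definition zero (X Y : A) : hom X Y := from_zob Y ∘ to_zob X.

Definition is_kernel (X Y K : A) (f : hom X Y) (k : hom K X) : Prop :=
  f ∘ k = zero K Y /\
  forall (W : A) (g : hom W X), f ∘ g = zero W Y -> exists! h : hom W K, k ∘ h = g.

Definition is_cokernel (X Y Q : A) (f : hom X Y) (q : hom Y Q) : Prop :=
  q ∘ f = zero X Q /\
  forall (W : A) (g : hom Y W), g ∘ f = zero X W -> exists! h : hom Q W, h ∘ q = g.

Definition has_kernels : Prop :=
  forall (X Y : A) (f : hom X Y), exists (K : A) (k : hom K X), is_kernel f k.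

Definition has_cokernels : Prop :=
  forall (X Y : A) (f : hom X Y), exists (Q : A) (q : hom Y Q), is_cokernel f q.

Definition normal_mono (M Y : A) (m : hom M Y) : Prop :=
  exists (Z : A) (g : hom Y Z), is_kernel g m.

Definition normal_epi (X M : A) (e : hom X M) : Prop :=
  exists (Z : A) (g : hom Z X), is_cokernel g e.

Definition has_epi_normal_mono_fact (X Y : A) (u : hom X Y) : Prop :=
  exists (M : A) (e : hom X M) (m : hom M Y), u = m ∘ e /\ epi e /\ normal_mono m.

Definition has_normal_epi_mono_fact (X Y : A) (u : hom X Y) : Prop :=
  exists (M : A) (e : hom X M) (m : hom M Y), u = m ∘ e /\ normal_epi e /\ mono m.

(* The canonical morphism [c : Coker u -> Coker v] is the one compatible with
   the cokernel maps; it is unique because these are epimorphisms. *)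
Definition same_cokernels (X X' Y : A) (u : hom X Y) (v : hom X' Y) : Prop :=
  forall (Q Q' : A) (q : hom Y Q) (q' : hom Y Q'),
    is_cokernel u q -> is_cokernel v q' ->
    exists c : hom Q Q', c ∘ q = q' /\ iso c.

(* The canonical morphism goes from [Ker v] to [Ker u]. *)
Definition same_kernels (X Y Y' : A) (u : hom X Y) (v : hom X Y') : Prop :=
  forall (K K' : A) (k : hom K X) (k' : hom K' X),
    is_kernel u k -> is_kernel v k' ->
    exists c : hom K' K, k ∘ c = k' /\ iso c.

Record pair := Pair {
  p0 : A; p1 : A; p2 : A;
  d0 : hom p0 p1;
  d1 : hom p1 p2;
  d1d0 : d1 ∘ d0 = zero p0 p2
}.

Record pair_hom (X Y : pair) := PairHom {
  h0 : hom (p0 X) (p0 Y);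
  h1 : hom (p1 X) (p1 Y);
  h2 : hom (p2 X) (p2 Y);
  h_d0 : h1 ∘ d0 X = d0 Y ∘ h0;
  h_d1 : h2 ∘ d1 X = d1 Y ∘ h1
}.

Lemma pair_hom_eq (X Y : pair) (g h : pair_hom X Y) :
  h0 g = h0 h -> h1 g = h1 h -> h2 g = h2 h -> g = h.
Proof.
destruct g as [g0 g1 g2 e0 e1], h as [k0 k1 k2 e0' e1']; simpl.
intros -> -> ->; f_equal; apply proof_irrelevance.
Qed.

Definition pair_id (X : pair) : pair_hom X X.
Proof.
refine (@PairHom X X (idm _) (idm _) (idm _) _ _);
  now rewrite comp1m, compm1.
Defined.

Definition pair_comp (X Y Z : pair) (g : pair_hom Y Z) (f : pair_hom X Y) :
  pair_hom X Z.
Proof.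
refine (@PairHom X Z (h0 g ∘ h0 f) (h1 g ∘ h1 f) (h2 g ∘ h2 f) _ _).
- now rewrite <- compA, h_d0, !compA, h_d0.
- now rewrite <- compA, h_d1, !compA, h_d1.
Defined.

Definition pairs : category.
Proof.
refine (@Category pair pair_hom pair_id pair_comp _ _ _); intros;
  apply pair_hom_eq; simpl; first [apply comp1m | apply compm1 | apply compA].
Defined.

Definition cokernel_diagram (X : pairs) : Prop := is_cokernel (d0 X) (d1 X).

Definition kernel_diagram (X : pairs) : Prop := is_kernel (d1 X) (d0 X).

(* The cokernel of [d0 X] (the kernel of [d1 X]) is chosen for each pair [X]
   rather than for each morphism: being [d1 X] whenever [X] is a cokernel
   diagram is a condition that depends on the whole of [X]. *)
Record cokernel_choice := CokernelChoice {
  cok_ob : pairs -> A;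
  cok : forall X : pairs, hom (p1 X) (cok_ob X);
  cokP : forall X : pairs, is_cokernel (d0 X) (cok X);
  cok_id : forall X : pairs, cokernel_diagram X ->
    existT (fun Q => hom (p1 X) Q) (cok_ob X) (cok X) = existT _ (p2 X) (d1 X)
}.

Record kernel_choice := KernelChoice {
  ker_ob : pairs -> A;
  ker : forall X : pairs, hom (ker_ob X) (p1 X);
  kerP : forall X : pairs, is_kernel (d1 X) (ker X);
  ker_id : forall X : pairs, kernel_diagram X ->
    existT (fun Z => hom Z (p1 X)) (ker_ob X) (ker X) =
    existT (fun Z => hom Z (p1 X)) (p0 X) (d0 X)
}.

Lemma cokernel_choice_exists : has_cokernels -> inhabited cokernel_choice.
Proof.
intros hc.
assert (H : forall X : pairs, exists s : {Q : A & hom (p1 X) Q},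
  is_cokernel (d0 X) (projT2 s) /\
  (cokernel_diagram X -> s = existT _ (p2 X) (d1 X))).
{ intros X; destruct (classic (cokernel_diagram X)) as [hX | hX].
  - now exists (existT _ (p2 X) (d1 X)).
  - destruct (hc _ _ (d0 X)) as (Q & q & hq).
    now exists (existT _ Q q). }
pose (s X := constructive_indefinite_description _ (H X)).
constructor.
refine (@CokernelChoice (fun X => projT1 (proj1_sig (s X)))
                        (fun X => projT2 (proj1_sig (s X))) _ _).
- intros X; exact (proj1 (proj2_sig (s X))).
- intros X hX; rewrite <- (proj2 (proj2_sig (s X)) hX).
  now destruct (proj1_sig (s X)).
Qed.

Lemma kernel_choice_exists : has_kernels -> inhabited kernel_choice.
Proof.
intros hk.
assert (H : forall X : pairs, exists s : {K : A & hom K (p1 X)},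
  is_kernel (d1 X) (projT2 s) /\
  (kernel_diagram X -> s = existT (fun Z => hom Z (p1 X)) (p0 X) (d0 X))).
{ intros X; destruct (classic (kernel_diagram X)) as [hX | hX].
  - now exists (existT (fun Z => hom Z (p1 X)) (p0 X) (d0 X)).
  - destruct (hk _ _ (d1 X)) as (K & k & hkk).
    now exists (existT _ K k). }
pose (s X := constructive_indefinite_description _ (H X)).
constructor.
refine (@KernelChoice (fun X => projT1 (proj1_sig (s X)))
                      (fun X => projT2 (proj1_sig (s X))) _ _).
- intros X; exact (proj1 (proj2_sig (s X))).
- intros X hX; rewrite <- (proj2 (proj2_sig (s X)) hX).
  now destruct (proj1_sig (s X)).
Qed.

Lemma comp0m (X Y Z : A) (f : hom X Y) : zero Y Z ∘ f = zero X Z.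
Proof.
unfold zero; rewrite <- compA; f_equal; apply to_zob_unique.
Qed.

Lemma compm0 (X Y Z : A) (f : hom Y Z) : f ∘ zero X Y = zero X Z.
Proof.
unfold zero; rewrite compA; f_equal; apply from_zob_unique.
Qed.

Definition the (T : Type) (P : T -> Prop) (H : exists! x, P x) : T :=
  proj1_sig (constructive_definite_description P H).

Lemma theP (T : Type) (P : T -> Prop) (H : exists! x, P x) : P (the H).
Proof. exact (proj2_sig (constructive_definite_description P H)). Qed.

Lemma cokernel_epi (X Y Q : A) (f : hom X Y) (q : hom Y Q) :
  is_cokernel f q -> epi q.
Proof.
intros [q0 qU] Z a b ab.
destruct (qU Z (b ∘ q)) as (h & _ & hU).
{ now rewrite <- compA, q0, compm0. }
now rewrite <- (hU a ab), <- (hU b eq_refl).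
Qed.

Lemma kernel_mono (X Y K : A) (f : hom X Y) (k : hom K X) :
  is_kernel f k -> mono k.
Proof.
intros [k0 kU] W a b ab.
destruct (kU W (k ∘ b)) as (h & _ & hU).
{ now rewrite compA, k0, comp0m. }
now rewrite <- (hU a ab), <- (hU b eq_refl).
Qed.

Section Coreflection.
Variable Q : cokernel_choice.

Definition t_ob (X : pairs) : pairs :=
  @Pair (p0 X) (p1 X) (cok_ob Q X) (d0 X) (cok Q X) (proj1 (cokP Q X)).

Definition cok_desc (X : pairs) : hom (cok_ob Q X) (p2 X) :=
  the (proj2 (cokP Q X) (p2 X) (d1 X) (d1d0 X)).

Lemma cok_descE (X : pairs) : cok_desc X ∘ cok Q X = d1 X.
Proof. exact (theP (proj2 (cokP Q X) (p2 X) (d1 X) (d1d0 X))). Qed.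

Lemma t_map_proof (X Y : pairs) (g : hom X Y) :
  (cok Q Y ∘ h1 g) ∘ d0 X = zero (p0 X) (cok_ob Q Y).
Proof.
now rewrite <- compA, h_d0, compA, (proj1 (cokP Q Y)), comp0m.
Qed.

Definition t_map (X Y : pairs) (g : hom X Y) : pair_hom (t_ob X) (t_ob Y) :=
  let H := proj2 (cokP Q X) _ _ (t_map_proof g) in
  @PairHom (t_ob X) (t_ob Y) (h0 g) (h1 g) (the H) (h_d0 g) (theP H).

Lemma t_map_eq (X Y : pairs) (g h : pair_hom (t_ob X) Y) :
  h0 g = h0 h -> h1 g = h1 h -> g = h.
Proof.
intros e0 e1; apply pair_hom_eq; trivial.
apply (cokernel_epi (cokP Q X)).
pose proof (h_d1 g) as eg; pose proof (h_d1 h) as eh; simpl in eg, eh.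
now rewrite eg, eh, e1.
Qed.

Definition t_functor : functor pairs pairs.
Proof.
refine (@Functor pairs pairs t_ob t_map _ _); intros; now apply t_map_eq.
Defined.

Lemma t_in (X : pairs) : cokernel_diagram (t_ob X).
Proof. exact (cokP Q X). Qed.

Definition t_counit (X : pairs) : hom (t_functor X) X.
Proof.
refine (@PairHom (t_functor X) X (idm _) (idm _) (cok_desc X) _ _); simpl.
- now rewrite comp1m, compm1.
- now rewrite compm1, cok_descE.
Defined.

Lemma t_counit_natural (X Y : pairs) (g : hom X Y) :
  g ∘ t_counit X = t_counit Y ∘ fmap t_functor g.
Proof.
apply t_map_eq; simpl; now rewrite comp1m, compm1.
Qed.

Lemma t_counit_universal (X Y : pairs) (g : hom X Y) :
  cokernel_diagram X ->
  exists! h : hom X (t_functor Y), t_counit Y ∘ h = g.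
Proof.
intros hX.
pose (H := proj2 hX _ _ (t_map_proof g)).
pose (h := @PairHom X (t_ob Y) (h0 g) (h1 g) (the H) (h_d0 g) (theP H)).
assert (eqX : forall (Z : pairs) (a b : hom X Z),
  h0 a = h0 b -> h1 a = h1 b -> a = b).
{ intros Z a b e0 e1; apply pair_hom_eq; trivial.
  apply (cokernel_epi hX).
  now rewrite (h_d1 a), (h_d1 b), e1. }
exists h; split.
- apply eqX; simpl; apply comp1m.
- intros h' <-; apply eqX; simpl; apply comp1m.
Qed.

Lemma t_counit_id (X : pairs) : cokernel_diagram X ->
  existT (fun Z : pairs => hom Z X) (t_functor X) (t_counit X) =
  existT (fun Z : pairs => hom Z X) X (idm X).
Proof.
intros hX.
assert (G : forall (s : {Z : A & hom (p1 X) Z})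
  (z : projT2 s ∘ d0 X = zero (p0 X) (projT1 s)) (c : hom (projT1 s) (p2 X))
  e0 e1, s = existT _ (p2 X) (d1 X) ->
  existT (fun Z : pairs => hom Z X) (Pair z)
    (@PairHom (Pair z) X (idm _) (idm _) c e0 e1) =
  existT (fun Z : pairs => hom Z X) X (idm X)).
{ intros s z c e0 e1 ->; simpl in *.
  assert (c = idm _) as ->.
  { apply (cokernel_epi hX); now rewrite e1, compm1, comp1m. }
  destruct X as [X0 X1 X2 u0 u1 z']; simpl in *.
  destruct (proof_irrelevance _ z z').
  f_equal; now apply pair_hom_eq. }
exact (G (existT _ _ (cok Q X)) _ _ _ _ (cok_id Q hX)).
Qed.

Definition t_coreflection : coreflection cokernel_diagram.
Proof.
refine (@Coreflection pairs _ t_functor t_counit t_in t_counit_natural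
  t_counit_universal _).
intros X Y g hX hY.
exact (arrow_conj_dom (t_counit_id hX) (t_counit_id hY) (t_counit_natural g)).
Defined.

End Coreflection.

Section Reflection.
Variable K : kernel_choice.

Definition f_ob (X : pairs) : pairs :=
  @Pair (ker_ob K X) (p1 X) (p2 X) (ker K X) (d1 X) (proj1 (kerP K X)).

Definition ker_lift (X : pairs) : hom (p0 X) (ker_ob K X) :=
  the (proj2 (kerP K X) (p0 X) (d0 X) (d1d0 X)).

Lemma ker_liftE (X : pairs) : ker K X ∘ ker_lift X = d0 X.
Proof. exact (theP (proj2 (kerP K X) (p0 X) (d0 X) (d1d0 X))). Qed.

Lemma f_map_proof (X Y : pairs) (g : hom X Y) :
  d1 Y ∘ (h1 g ∘ ker K X) = zero (ker_ob K X) (p2 Y).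
Proof.
now rewrite compA, <- h_d1, <- compA, (proj1 (kerP K X)), compm0.
Qed.

Definition f_map (X Y : pairs) (g : hom X Y) : pair_hom (f_ob X) (f_ob Y) :=
  let H := proj2 (kerP K Y) _ _ (f_map_proof g) in
  @PairHom (f_ob X) (f_ob Y) (the H) (h1 g) (h2 g) (eq_sym (theP H)) (h_d1 g).

Lemma f_map_eq (X Y : pairs) (g h : pair_hom X (f_ob Y)) :
  h1 g = h1 h -> h2 g = h2 h -> g = h.
Proof.
intros e1 e2; apply pair_hom_eq; trivial.
apply (kernel_mono (kerP K Y)).
pose proof (h_d0 g) as eg; pose proof (h_d0 h) as eh; simpl in eg, eh.
now rewrite <- eg, <- eh, e1.
Qed.

Definition f_functor : functor pairs pairs.
Proof.
refine (@Functor pairs pairs f_ob f_map _ _); intros; now apply f_map_eq.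
Defined.

Lemma f_in (X : pairs) : kernel_diagram (f_ob X).
Proof. exact (kerP K X). Qed.

Definition f_unit (X : pairs) : hom X (f_functor X).
Proof.
refine (@PairHom X (f_functor X) (ker_lift X) (idm _) (idm _) _ _); simpl.
- now rewrite comp1m, ker_liftE.
- now rewrite comp1m, compm1.
Defined.

Lemma f_unit_natural (X Y : pairs) (g : hom X Y) :
  fmap f_functor g ∘ f_unit X = f_unit Y ∘ g.
Proof.
apply f_map_eq; simpl; now rewrite comp1m, compm1.
Qed.

Lemma f_unit_universal (X Y : pairs) (g : hom X Y) :
  kernel_diagram Y ->
  exists! h : hom (f_functor X) Y, h ∘ f_unit X = g.
Proof.
intros hY.
pose (H := proj2 hY _ _ (f_map_proof g)).
pose (h := @PairHom (f_ob X) Y (the H) (h1 g) (h2 g) (eq_sym (theP H)) (h_d1 g)).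
assert (eqY : forall (Z : pairs) (a b : hom Z Y),
  h1 a = h1 b -> h2 a = h2 b -> a = b).
{ intros Z a b e1 e2; apply pair_hom_eq; trivial.
  apply (kernel_mono hY).
  now rewrite <- (h_d0 a), <- (h_d0 b), e1. }
exists h; split.
- apply eqY; simpl; apply compm1.
- intros h' <-; apply eqY; simpl; apply compm1.
Qed.

Lemma f_unit_id (X : pairs) : kernel_diagram X ->
  existT (fun Z : pairs => hom X Z) (f_functor X) (f_unit X) =
  existT _ X (idm X).
Proof.
intros hX.
assert (G : forall (s : {Z : A & hom Z (p1 X)})
  (z : d1 X ∘ projT2 s = zero (projT1 s) (p2 X)) (c : hom (p0 X) (projT1 s))
  e0 e1, s = existT (fun Z => hom Z (p1 X)) (p0 X) (d0 X) ->
  existT (fun Z : pairs => hom X Z) (Pair z)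
    (@PairHom X (Pair z) c (idm _) (idm _) e0 e1) = existT _ X (idm X)).
{ intros s z c e0 e1 ->; simpl in *.
  assert (c = idm _) as ->.
  { apply (kernel_mono hX); now rewrite <- e0, compm1, comp1m. }
  destruct X as [X0 X1 X2 u0 u1 z']; simpl in *.
  destruct (proof_irrelevance _ z z').
  f_equal; now apply pair_hom_eq. }
exact (G (existT (fun Z => hom Z (p1 X)) _ (ker K X)) _ _ _ _ (ker_id K hX)).
Qed.

Definition f_reflection : reflection kernel_diagram.
Proof.
refine (@Reflection pairs _ f_functor f_unit f_in f_unit_natural
  f_unit_universal _).
intros X Y g hX hY.
exact (arrow_conj_cod (f_unit_id hX) (f_unit_id hY) (f_unit_natural g)).
Defined.

End Reflection.

Lemma cokernel_diagram_replete : replete cokernel_diagram.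
Proof.
intros X Y g (g' & e1 & e2) [hz hU].
pose proof (f_equal (@h1 _ _) e2) as e21; pose proof (f_equal (@h2 _ _) e2) as e22.
simpl in e21, e22.
split; [exact (d1d0 Y) |].
intros W w hw.
destruct (hU W (w ∘ h1 g)) as (k & hk & kU).
{ now rewrite <- compA, h_d0, compA, hw, comp0m. }
exists (k ∘ h2 g'); split.
- now rewrite <- compA, h_d1, compA, hk, <- compA, e21, compm1.
- intros k' <-.
  rewrite (kU (k' ∘ h2 g)).
  + now rewrite <- compA, e22, compm1.
  + now rewrite <- compA, h_d1, compA.
Qed.

Lemma kernel_diagram_replete : replete kernel_diagram.
Proof.
intros X Y g (g' & e1 & e2) [hz hU].
pose proof (f_equal (@h0 _ _) e2) as e20; pose proof (f_equal (@h1 _ _) e2) as e21.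
simpl in e20, e21.
split; [exact (d1d0 Y) |].
intros W w hw.
destruct (hU W (h1 g' ∘ w)) as (k & hk & kU).
{ now rewrite compA, <- h_d1, <- compA, hw, compm0. }
exists (h0 g ∘ k); split.
- now rewrite compA, <- h_d0, <- compA, hk, compA, e21, comp1m.
- intros k' <-.
  rewrite (kU (h0 g' ∘ k')).
  + now rewrite compA, e20, comp1m.
  + now rewrite compA, <- h_d0, <- compA.
Qed.

Lemma t_kernel_diagram (Q : cokernel_choice) (X : pairs) :
  kernel_diagram X -> kernel_diagram (t_functor Q X).
Proof.
intros [hz hU]; split; [exact (d1d0 (t_ob Q X)) |]; simpl.
intros W g hg; apply hU.
now rewrite <- (cok_descE Q X), <- compA, hg, compm0.
Qed.

Lemma f_cokernel_diagram (K : kernel_choice) (X : pairs) :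
  cokernel_diagram X -> cokernel_diagram (f_functor K X).
Proof.
intros [hz hU]; split; [exact (d1d0 (f_ob K X)) |]; simpl.
intros W g hg; apply hU.
now rewrite <- (ker_liftE K X), compA, hg, comp0m.
Qed.

Definition cokernel_kernel_ntt (Q : cokernel_choice) (K : kernel_choice) :
    near_torsion_theory pairs :=
  NearTorsionTheory cokernel_diagram_replete kernel_diagram_replete
    (tpart := t_coreflection Q) (fpart := f_reflection K)
    (t_kernel_diagram Q) (f_cokernel_diagram K).

End Pointed.

(* Main.v *)
(** Write [q] for the cokernel of [d0 B] and [k] for the kernel of [d1 B].  Each
    of the pullback condition, the pushout condition and the two forms of (c) is
    equivalent to the single equation [q ∘ k = 0].  For the pullback this is seen
    by testing it against the pair [(d0 B, coker k)].  The morphism [eta] at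
    [t B] is the identity except for [B0 -> Ker q], so it is epi exactly when that
    morphism is.  If [d0 B = m ∘ e] with [e] epi and [m] a normal mono, then [m] is
    the kernel of [q]; hence this is condition (a).  Dually for (b). *)
Require Import Defs.

Set Implicit Arguments.
Unset Strict Implicit.

(** * Split and composite epimorphisms and monomorphisms *)

Section InCategory.
Variable C : category.

Lemma epi_split (X Y : C) (f : hom X Y) (g : hom Y X) : f ∘ g = idm Y -> epi f.
Proof.
intros fg Z a b ab.
now rewrite <- (compm1 a), <- (compm1 b), <- fg, !compA, ab.
Qed.

Lemma mono_split (X Y : C) (f : hom X Y) (g : hom Y X) : g ∘ f = idm X -> mono f.
Proof.
intros gf Z a b ab.
now rewrite <- (comp1m a), <- (comp1m b), <- gf, <- !compA, ab.
Qed.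

Lemma epi_comp (X Y Z : C) (g : hom Y Z) (f : hom X Y) :
  epi g -> epi f -> epi (g ∘ f).
Proof. intros hg hf W a b; rewrite !compA; intros ab; exact (hg _ _ _ (hf _ _ _ ab)). Qed.

Lemma mono_comp (X Y Z : C) (g : hom Y Z) (f : hom X Y) :
  mono g -> mono f -> mono (g ∘ f).
Proof. intros hg hf W a b; rewrite <- !compA; intros ab; exact (hf _ _ _ (hg _ _ _ ab)). Qed.

End InCategory.

(** * Factorizations, and comparison of kernels and cokernels, in the base category *)

Section Pointed.
Variable A : pointed_category.

(** Any normal mono [m] in such a factorization is the same subobject as [n]: [q] kills [m] because
    [e'] is epi, and the map [g] of which [m] is a kernel kills [u], hence factors through [q] and
    kills [n]. *)
Lemma epi_normal_mono_fact_iff (X Y Z N : A) (u : hom X Y) (q : hom Y Z)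
    (n : hom N Y) (e : hom X N) :
  is_cokernel u q -> is_kernel q n -> n ∘ e = u ->
  has_epi_normal_mono_fact u <-> epi e.
Proof.
intros hq hn ne; split.
- intros (M & e' & m & -> & epe & W & g & hm).
  assert (qm : q ∘ m = zero M Z).
  { apply epe; rewrite <- compA, comp0m; apply (proj1 hq). }
  destruct (proj2 hn _ _ qm) as (m' & nm' & _).
  destruct (proj2 hq _ g) as (g' & gq & _).
  { now rewrite compA, (proj1 hm), comp0m. }
  destruct (proj2 hm _ n) as (n' & mn' & _).
  { now rewrite <- gq, <- compA, (proj1 hn), compm0. }
  assert (e = m' ∘ e') as ->.
  { apply (kernel_mono hn); now rewrite ne, compA, nm'. }
  apply epi_comp; trivial.
  (* [n'] is a section of [m']: [n ∘ m' ∘ n' = m ∘ n' = n], and [n] is mono. *)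
  apply epi_split with n', (kernel_mono hn).
  now rewrite compA, nm', mn', compm1.
- intros epe; exists N, e, n; repeat split; trivial; [now symmetry | now exists Z, q].
Qed.

Lemma normal_epi_mono_fact_iff (X Y Z N : A) (u : hom X Y) (k : hom Z X)
    (n : hom X N) (e : hom N Y) :
  is_kernel u k -> is_cokernel k n -> e ∘ n = u ->
  has_normal_epi_mono_fact u <-> mono e.
Proof.
intros hk hn en; split.
- intros (M & m & e' & -> & (W & g & hm) & moe).
  assert (mk : m ∘ k = zero Z M).
  { apply moe; rewrite compA, compm0; apply (proj1 hk). }
  destruct (proj2 hn _ _ mk) as (m' & nm' & _).
  destruct (proj2 hk _ g) as (g' & gk & _).
  { now rewrite <- compA, (proj1 hm), compm0. }
  destruct (proj2 hm _ n) as (n' & mn' & _).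
  { now rewrite <- gk, compA, (proj1 hn), comp0m. }
  assert (e = e' ∘ m') as ->.
  { apply (cokernel_epi hn); now rewrite en, <- compA, nm'. }
  apply mono_comp; trivial.
  apply mono_split with n', (cokernel_epi hn).
  now rewrite <- compA, nm', mn', comp1m.
- intros moe; exists N, n, e; repeat split; trivial; [now symmetry | now exists Z, k].
Qed.

(** Since [u] factors through [v], there is always a canonical map [Coker u -> Coker v]; an inverse
    exists exactly when the cokernel of [u] also kills [v]. *)
Lemma same_cokernels_iff_zero (X X' Y Q Q' : A) (u : hom X Y) (v : hom X' Y)
    (w : hom X X') (q : hom Y Q) (q' : hom Y Q') :
  v ∘ w = u -> is_cokernel u q -> is_cokernel v q' ->
  same_cokernels u v <-> q ∘ v = zero X' Q.
Proof.
intros <- hq hq'; split.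
- intros h; destruct (h _ _ _ _ hq hq') as (c & cq & c' & c'c & _).
  now rewrite <- (comp1m q), <- c'c, <- (compA c'), cq, <- compA, (proj1 hq'), compm0.
- intros qv R R' r r' hr hr'.
  destruct (proj2 hr _ r') as (c & cr & _).
  { now rewrite compA, (proj1 hr'), comp0m. }
  (* The equation known for [q] passes to an arbitrary cokernel [r] of [u], which factors through
     [q]. *)
  assert (rv : r ∘ v = zero X' R).
  { destruct (proj2 hq _ r (proj1 hr)) as (s & <- & _).
    now rewrite <- compA, qv, compm0. }
  destruct (proj2 hr' _ r rv) as (c' & c'r' & _).
  exists c; split; trivial; exists c'; split.
  + apply (cokernel_epi hr); now rewrite <- compA, cr, c'r', comp1m.
  + apply (cokernel_epi hr'); now rewrite <- compA, c'r', cr, comp1m.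
Qed.

Lemma same_kernels_iff_zero (X Y Y' K K' : A) (u : hom X Y) (v : hom X Y')
    (w : hom Y' Y) (k : hom K X) (k' : hom K' X) :
  w ∘ v = u -> is_kernel u k -> is_kernel v k' ->
  same_kernels u v <-> v ∘ k = zero K Y'.
Proof.
intros <- hk hk'; split.
- intros h; destruct (h _ _ _ _ hk hk') as (c & kc & c' & _ & cc').
  now rewrite <- (compm1 k), <- cc', (compA k), kc, compA, (proj1 hk'), comp0m.
- intros vk R R' r r' hr hr'.
  destruct (proj2 hr _ r') as (c & cr & _).
  { now rewrite <- compA, (proj1 hr'), compm0. }
  assert (vr : v ∘ r = zero R Y').
  { destruct (proj2 hk _ r (proj1 hr)) as (s & <- & _).
    now rewrite compA, vk, comp0m. }
  destruct (proj2 hr' _ r vr) as (c' & c'r' & _).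
  exists c; split; trivial; exists c'; split.
  + apply (kernel_mono hr'); now rewrite compA, c'r', cr, compm1.
  + apply (kernel_mono hr); now rewrite compA, cr, c'r', compm1.
Qed.

(** * Epi units and mono counits, read off a single component *)

Lemma f_unit_epi (K : kernel_choice A) (X : pairs A) :
  epi (f_unit K X) <-> epi (ker_lift K X).
Proof.
split.
- intros h Z a b ab.
  (* Maps into [Z -> 0 -> 0] detect the first component. *)
  pose (P := @Pair A Z (zob A) (zob A) (zero _ _) (zero _ _) (comp0m _ _)).
  assert (tz : forall (W : A) (x y : hom W (zob A)), x = y).
  { intros W x y; now rewrite (to_zob_unique x), (to_zob_unique y). }
  pose (lift (g : hom (ker_ob K X) Z) := @PairHom A (f_ob K X) P g
    (to_zob _) (to_zob _) (tz _ _ _) (tz _ _ _)).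
  assert (E : lift a = lift b).
  { apply h, pair_hom_eq; simpl; trivial. }
  exact (f_equal (@h0 _ _ _) E).
- intros h Z a b ab; apply pair_hom_eq.
  + apply h; exact (f_equal (@h0 _ _ _) ab).
  + pose proof (f_equal (@h1 _ _ _) ab) as E; simpl in E; now rewrite !compm1 in E.
  + pose proof (f_equal (@h2 _ _ _) ab) as E; simpl in E; now rewrite !compm1 in E.
Qed.

Lemma t_counit_mono (Q : cokernel_choice A) (X : pairs A) :
  mono (t_counit Q X) <-> mono (cok_desc Q X).
Proof.
split.
- intros h Z a b ab.
  (* Maps out of [0 -> 0 -> Z] detect the last component. *)
  pose (P := @Pair A (zob A) (zob A) Z (zero _ _) (zero _ _) (comp0m _ _)).
  assert (fz : forall (W : A) (x y : hom (zob A) W), x = y).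
  { intros W x y; now rewrite (from_zob_unique x), (from_zob_unique y). }
  pose (lift (g : hom Z (cok_ob Q X)) := @PairHom A P (t_ob Q X)
    (from_zob _) (from_zob _) g (fz _ _ _) (fz _ _ _)).
  assert (E : lift a = lift b).
  { apply h, pair_hom_eq; simpl; trivial. }
  exact (f_equal (@h2 _ _ _) E).
- intros h Z a b ab; apply pair_hom_eq.
  + pose proof (f_equal (@h0 _ _ _) ab) as E; simpl in E; now rewrite !comp1m in E.
  + pose proof (f_equal (@h1 _ _ _) ab) as E; simpl in E; now rewrite !comp1m in E.
  + apply h; exact (f_equal (@h2 _ _ _) ab).
Qed.

(** * The pullback and pushout squares *)

Section Square.
Variables (Q : cokernel_choice A) (K : kernel_choice A) (B : pairs A).

(** The counits are identities in degrees 0 and 1, so only degree 2 matters. There [eta B] is an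
    identity, and the opposite side is the canonical [c : Coker (d0 B) -> Coker k], which must be
    invertible. *)
Lemma pullback_iff_zero :
  is_pullback (t_counit Q B) (fmap (t_functor Q) (f_unit K B))
    (f_unit K B) (t_counit Q (f_functor K B)) <->
  cok Q B ∘ ker K B = zero (ker_ob K B) (cok_ob Q B).
Proof.
pose proof (cokP Q (f_ob K B)) as hq'; simpl in hq'.
pose proof (cok_descE Q (f_ob K B)) as mq'; simpl in mq'.
pose (c := h2 (fmap (t_functor Q) (f_unit K B)) : hom (cok_ob Q B) (cok_ob Q (f_ob K B))).
assert (cq : c ∘ cok Q B = cok Q (f_ob K B)).
{ rewrite <- (compm1 (cok Q (f_ob K B))).
  exact (h_d1 (fmap (t_functor Q) (f_unit K B))). }
split.
- intros [_ U].
  assert (z : cok Q (f_ob K B) ∘ d0 B = zero (p0 B) (cok_ob Q (f_ob K B))).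
  { now rewrite <- (ker_liftE K B), compA, (proj1 hq'), comp0m. }
  pose (W := Pair z).
  unshelve epose (a := @PairHom A W B (idm _) (idm _) (cok_desc Q (f_ob K B)) _ _); simpl.
  { now rewrite comp1m, compm1. }
  { now rewrite compm1, mq'. }
  unshelve epose (b := @PairHom A W (t_ob Q (f_ob K B)) (ker_lift K B) (idm _) (idm _) _ _);
    simpl.
  { now rewrite comp1m, ker_liftE. }
  { now rewrite comp1m, compm1. }
  destruct (U W a b) as (h & [ha _] & _).
  { apply f_map_eq; simpl; now rewrite ?comp1m, ?compm1. }
  (* [h] is the identity in degree 1, so its degree 2 component factors [q] through the cokernel of
     [k]. *)
  pose proof (h_d1 h) as E; simpl in E.
  pose proof (f_equal (@h1 _ _ _) ha) as E1; simpl in E1; rewrite comp1m in E1.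
  rewrite E1, compm1 in E.
  now rewrite <- E, <- compA, (proj1 hq'), compm0.
- intros qk; split; [now apply t_map_eq; simpl; rewrite ?comp1m, ?compm1 |].
  (* [s] is the inverse of [c], obtained from [q ∘ k = 0]. *)
  destruct (proj2 hq' _ _ qk) as (s & sq' & _).
  assert (cs : c ∘ s = idm _).
  { apply (cokernel_epi hq'); now rewrite <- compA, sq', cq, comp1m. }
  assert (sc : s ∘ c = idm _).
  { apply (cokernel_epi (cokP Q B)); now rewrite <- compA, cq, sq', comp1m. }
  assert (ds : cok_desc Q B ∘ s = cok_desc Q (f_ob K B)).
  { apply (cokernel_epi hq').
    now rewrite <- compA, sq', cok_descE, mq'. }
  intros W a b ab.
  pose proof (f_equal (@h0 _ _ _) ab) as e0; pose proof (f_equal (@h1 _ _ _) ab) as e1;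
    pose proof (f_equal (@h2 _ _ _) ab) as e2.
  simpl in e0, e1, e2; rewrite !comp1m in *.
  unshelve epose (h := @PairHom A W (t_ob Q B) (h0 a) (h1 a) (s ∘ h2 b) _ _); simpl.
  { apply h_d0. }
  { pose proof (h_d1 b) as b1; simpl in b1; now rewrite <- compA, b1, compA, sq', e1. }
  exists h; split; [split |].
  + apply pair_hom_eq; simpl; rewrite ?comp1m; trivial.
    now rewrite compA, ds.
  + apply pair_hom_eq; simpl; rewrite ?comp1m; trivial.
    (* [change] folds the degree 2 component of [t(eta B)] back into [c]. *)
    rewrite compA; change (c ∘ s ∘ h2 b = h2 b); now rewrite cs, comp1m.
  + intros h' [<- <-]; apply pair_hom_eq; simpl; rewrite ?comp1m; trivial.
    rewrite compA; change (s ∘ c ∘ h2 h' = h2 h'); now rewrite sc, comp1m.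
Qed.

(** Dually, only degree 0 matters, where the canonical [c : Ker q -> Ker (d1 B)] must be
    invertible. *)
Lemma pushout_iff_zero :
  is_pushout (t_counit Q B) (f_unit K (t_functor Q B))
    (f_unit K B) (fmap (f_functor K) (t_counit Q B)) <->
  cok Q B ∘ ker K B = zero (ker_ob K B) (cok_ob Q B).
Proof.
pose proof (kerP K (t_ob Q B)) as hk'; simpl in hk'.
pose proof (ker_liftE K (t_ob Q B)) as kl'; simpl in kl'.
pose (c := h0 (fmap (f_functor K) (t_counit Q B)) : hom (ker_ob K (t_ob Q B)) (ker_ob K B)).
assert (kc : ker K B ∘ c = ker K (t_ob Q B)).
{ rewrite <- (comp1m (ker K (t_ob Q B))); symmetry.
  exact (h_d0 (fmap (f_functor K) (t_counit Q B))). }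
split.
- intros [_ U].
  assert (z : d1 B ∘ ker K (t_ob Q B) = zero (ker_ob K (t_ob Q B)) (p2 B)).
  { now rewrite <- (cok_descE Q B), <- compA, (proj1 hk'), compm0. }
  (* The test pair is now [(ker q, d1 B)]. *)
  pose (W := Pair z).
  unshelve epose (a := @PairHom A B W (ker_lift K (t_ob Q B)) (idm _) (idm _) _ _); simpl.
  { now rewrite comp1m, kl'. }
  { now rewrite comp1m, compm1. }
  unshelve epose (b := @PairHom A (f_ob K (t_ob Q B)) W (idm _) (idm _) (cok_desc Q B) _ _);
    simpl.
  { now rewrite comp1m, compm1. }
  { now rewrite compm1, cok_descE. }
  destruct (U W a b) as (h & [ha _] & _).
  { apply t_map_eq; simpl; now rewrite ?comp1m, ?compm1. }
  (* [h] is the identity in degree 1, so its degree 0 component factors [k] through the kernel of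
     [q]. *)
  pose proof (h_d0 h) as E; simpl in E.
  pose proof (f_equal (@h1 _ _ _) ha) as E1; simpl in E1; rewrite compm1 in E1.
  rewrite E1, comp1m in E.
  now rewrite E, compA, (proj1 hk'), comp0m.
- intros qk; split; [now apply f_map_eq; simpl; rewrite ?comp1m, ?compm1 |].
  destruct (proj2 hk' _ _ qk) as (s & k's & _).
  assert (cs : c ∘ s = idm _).
  { apply (kernel_mono (kerP K B)); now rewrite compA, kc, k's, compm1. }
  assert (sc : s ∘ c = idm _).
  { apply (kernel_mono hk'); now rewrite compA, k's, kc, compm1. }
  assert (sl : s ∘ ker_lift K B = ker_lift K (t_ob Q B)).
  { apply (kernel_mono hk').
    now rewrite compA, k's, ker_liftE, kl'. }
  intros W a b ab.
  pose proof (f_equal (@h0 _ _ _) ab) as e0; pose proof (f_equal (@h1 _ _ _) ab) as e1;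
    pose proof (f_equal (@h2 _ _ _) ab) as e2.
  simpl in e0, e1, e2; rewrite !compm1 in *.
  unshelve epose (h := @PairHom A (f_ob K B) W (h0 b ∘ s) (h1 a) (h2 a) _ _); simpl.
  { pose proof (h_d0 b) as b0; simpl in b0; now rewrite compA, <- b0, <- compA, k's, e1. }
  { apply h_d1. }
  exists h; split; [split |].
  + apply pair_hom_eq; simpl; rewrite ?compm1; trivial.
    now rewrite <- compA, sl.
  + apply pair_hom_eq; simpl; rewrite ?compm1; trivial.
    rewrite <- compA; change (h0 b ∘ (s ∘ c) = h0 b); now rewrite sc, compm1.
  + intros h' [<- <-]; apply pair_hom_eq; simpl; rewrite ?compm1; trivial.
    rewrite <- compA; change (h0 h' ∘ (c ∘ s) = h0 h'); now rewrite cs, compm1.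
Qed.

End Square.

End Pointed.

(** * Reduction of membership to the three conditions *)

Theorem theorem3p1 (A : pointed_category)
  (hasker : has_kernels A) (hascok : has_cokernels A)
  (Q : cokernel_choice A) (K : kernel_choice A) (B : pairs A) :
  (C_TF (cokernel_kernel_ntt Q K) B <->
     has_epi_normal_mono_fact (d0 B) /\
     has_normal_epi_mono_fact (d1 B) /\
     (forall (X : A) (k : hom X (p1 B)),
        is_kernel (d1 B) k -> same_cokernels (d0 B) k)) /\
  ((forall (X : A) (k : hom X (p1 B)),
      is_kernel (d1 B) k -> same_cokernels (d0 B) k) <->
   (forall (X : A) (q : hom (p1 B) X),
      is_cokernel (d0 B) q -> same_kernels (d1 B) q)).
Proof.
assert (hc : (forall (X : A) (k : hom X (p1 B)),
    is_kernel (d1 B) k -> same_cokernels (d0 B) k) <->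
  cok Q B ∘ ker K B = zero (ker_ob K B) (cok_ob Q B)).
(* The first map of [f_ob K B] is [ker K B], so the choice [Q] at this pair supplies a cokernel of
   [k]. *)
{ rewrite <- (same_cokernels_iff_zero (ker_liftE K B) (cokP Q B) (cokP Q (f_ob K B))).
  split; [intros h; apply h, kerP |].
  intros h X k hk.
  destruct (hascok _ _ k) as (R & r & hr).
  destruct (proj2 hk _ _ (d1d0 B)) as (w & kw & _).
  apply (same_cokernels_iff_zero kw (cokP Q B) hr).
  (* An arbitrary kernel factors through the chosen one, so [q] kills it too. *)
  destruct (proj2 (kerP K B) _ k (proj1 hk)) as (v & <- & _).
  rewrite compA.
  rewrite (proj1 (same_cokernels_iff_zero (ker_liftE K B) (cokP Q B) (cokP Q (f_ob K B))) h).
  apply comp0m. }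
assert (hk : (forall (X : A) (q : hom (p1 B) X),
    is_cokernel (d0 B) q -> same_kernels (d1 B) q) <->
  cok Q B ∘ ker K B = zero (ker_ob K B) (cok_ob Q B)).
{ rewrite <- (same_kernels_iff_zero (cok_descE Q B) (kerP K B) (kerP K (t_ob Q B))).
  split; [intros h; apply h, cokP |].
  intros h X q hq.
  destruct (hasker _ _ q) as (R & r & hr).
  destruct (proj2 hq _ _ (d1d0 B)) as (w & wq & _).
  apply (same_kernels_iff_zero wq (kerP K B) hr).
  destruct (proj2 (cokP Q B) _ q (proj1 hq)) as (v & <- & _).
  rewrite <- compA.
  rewrite (proj1 (same_kernels_iff_zero (cok_descE Q B) (kerP K B) (kerP K (t_ob Q B))) h).
  apply compm0. }
split; [| now rewrite hc, hk].
rewrite hc.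
(* The second map of [t_ob Q B] is [q], so [ker K (t_ob Q B)] is a kernel of [q]. *)
rewrite (epi_normal_mono_fact_iff (cokP Q B) (kerP K (t_ob Q B)) (ker_liftE K (t_ob Q B))).
rewrite (normal_epi_mono_fact_iff (kerP K B) (cokP Q (f_ob K B)) (cok_descE Q (f_ob K B))).
rewrite <- (f_unit_epi K (t_ob Q B)), <- (t_counit_mono Q (f_ob K B)).
unfold C_TF, tors_ring, tfree_ring; simpl.
rewrite (pullback_iff_zero Q K B), (pushout_iff_zero Q K B).
pose proof (t_in Q B); pose proof (f_in K B); tauto.
Qed.
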